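(* Let $\sigma:\mathbb R^n\to\mathbb R^{n\times m}$ be of class $C^2$, with columns $\sigma_1,\dots,\sigma_m$, and let $u:\mathbb R^n\to\mathbb R$ be of class $C^3$. Let $\bar x\in\mathbb R^n$ be a point such that $\nabla u(\bar x)\cdot\sigma_i(\bar x)=0$ for all $i=1,\dots,m$, and suppose that $$\max_{a_1,a_2\in B_1(0)}\Big\{ -\mathrm{Tr}\big(D^2u\, \sigma(a_1+a_2)\otimes\sigma(a_1+a_2) (\bar x)\big)-\big(D(\sigma (a_1+a_2))\,\sigma (a_1+a_2)+[\sigma a_1,\sigma a_2]\big)(\bar x)\cdot\nabla u(\bar x)\Big\}>0.$$ Then the target $\{x:u(x)\leq u(\bar x)\}$ is small time locally attainable (STLA) by the system $\dot x_t=\sigma(x_t)a_t$ at $\bar x$.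
   Context: The control system is $\dot x_t=\sigma(x_t)a_t$, $x_0\in\mathbb R^n$, with controls $a_\cdot:[0,+\infty)\to B_1(0)=\{a\in\mathbb R^m:|a|\le 1\}$ piecewise continuous. For $a\in\mathbb R^m$, $\sigma a$ denotes the vector field $x\mapsto\sigma(x)a$, and $D(\sigma a)$ its Jacobian matrix. For $C^1$ vector fields $f,g$, the Lie bracket is $[f,g](x)=Dg(x)f(x)-Df(x)g(x)$, where $Df=(\partial_{x_j}f_i)_{i,j}$ is the Jacobian. For $v\in\mathbb R^n$, $\mathrm{Tr}(D^2u\, v\otimes v)=D^2u\,v\cdot v$. A target $\mathbf T=\{x:u(x)\le u(\bar x)\}$ is STLA at $\bar x$ if for every $t>0$ the point $\bar x$ lies in the interior of the set of initial points from which some admissible trajectory of the system reaches $\mathbf T$ in time less than $t$. *)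

(* Defs.v *)
From HB Require Import structures.
From mathcomp Require Import all_boot all_order all_algebra.
From mathcomp Require Import all_classical all_reals all_analysis.
Set Implicit Arguments. Unset Strict Implicit. Unset Printing Implicit Defensive.
Import Order.TTheory GRing.Theory Num.Theory.
Import numFieldNormedType.Exports.
Local Open Scope classical_set_scope.
Local Open Scope ring_scope.

Section Defs.
Variable R : realType.

Definition evec (n : nat) (j : 'I_n) : 'rV[R]_n := delta_mx 0 j.

Definition partial (n : nat) (W : normedModType R) (j : 'I_n)
  (f : 'rV[R]_n -> W) : 'rV[R]_n -> W := fun x => 'D_(evec j) f x.

Fixpoint Ck (n : nat) (W : normedModType R) (k : nat) (f : 'rV[R]_n -> W) : Prop :=
  match k with
  | 0 => continuous f
  | k'.+1 => continuous f /\ (forall j x, derivable f x (evec j)) /\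
             (forall j, Ck k' (partial j f))
  end.

Definition dotv (n : nat) (v w : 'rV[R]_n) : R := \sum_(i < n) v ord0 i * w ord0 i.

Definition unit_ball (m : nat) : set 'rV[R]_m := [set a | dotv a a <= 1].

Definition grad (n : nat) (u : 'rV[R]_n -> R) (x : 'rV[R]_n) : 'rV[R]_n :=
  \row_j partial j u x.
Definition hess (n : nat) (u : 'rV[R]_n -> R) (x : 'rV[R]_n) : 'M[R]_n :=
  \matrix_(i, j) partial i (partial j u) x.
Definition jac (n : nat) (f : 'rV[R]_n -> 'rV[R]_n) (x : 'rV[R]_n) : 'M[R]_n :=
  \matrix_(i, j) (partial j f x) ord0 i.

Definition mxapp (n : nat) (M : 'M[R]_n) (v : 'rV[R]_n) : 'rV[R]_n := (M *m v^T)^T.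

Definition trvv (n : nat) (A : 'M[R]_n) (v : 'rV[R]_n) : R := \tr (A *m (v^T *m v)).

Definition lie (n : nat) (f g : 'rV[R]_n -> 'rV[R]_n) (x : 'rV[R]_n) : 'rV[R]_n :=
  mxapp (jac g x) (f x) - mxapp (jac f x) (g x).

(* the vector field x |-> sigma(x) a, sigma given by its columns sigma_i *)
Definition sigma_a (n m : nat) (sigma : 'I_m -> 'rV[R]_n -> 'rV[R]_n)
  (a : 'rV[R]_m) : 'rV[R]_n -> 'rV[R]_n :=
  fun x => \sum_(i < m) a ord0 i *: sigma i x.

(* piecewise continuous on [0,+oo): there is a strictly increasing unbounded
   sequence 0 = t_0 < t_1 < ... such that on each (t_k, t_{k+1}) the function
   coincides with a function continuous on [t_k, t_{k+1}] (i.e. it is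
   continuous there with finite one-sided limits at the endpoints) *)
Definition partition_seq (tk : nat -> R) : Prop :=
  tk 0%N = 0 /\ (forall k, tk k < tk k.+1) /\ (forall M : R, exists k, M < tk k).

Definition piecewise_continuous (m : nat) (a : R -> 'rV[R]_m) : Prop :=
  exists tk : nat -> R, partition_seq tk /\
    forall k, exists g : R -> 'rV[R]_m,
      {within `[tk k, tk k.+1], continuous g} /\
      forall s, tk k < s < tk k.+1 -> a s = g s.

Definition admissible_control (m : nat) (a : R -> 'rV[R]_m) : Prop :=
  piecewise_continuous a /\ forall s : R, 0 <= s -> unit_ball (a s).

(* x is a solution on [0, tau] of x' = sigma(x) a with x(0) = x0:
   x continuous on [0,tau], and the ODE holds (with genuine derivative)
   at every time of (0,tau) outside a locally finite set of times *)
Definition solution_on (n m : nat) (sigma : 'I_m -> 'rV[R]_n -> 'rV[R]_n)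
  (a : R -> 'rV[R]_m) (x0 : 'rV[R]_n) (tau : R) (x : R -> 'rV[R]_n) : Prop :=
  x 0 = x0 /\ {within `[0, tau], continuous x} /\
  exists tk : nat -> R, partition_seq tk /\
    forall s, 0 < s < tau -> (forall k, s <> tk k) ->
      is_derive s 1 x (sigma_a sigma (a s) (x s)).

Definition reach_set (n m : nat) (sigma : 'I_m -> 'rV[R]_n -> 'rV[R]_n)
  (u : 'rV[R]_n -> R) (xbar : 'rV[R]_n) (t : R) : set 'rV[R]_n :=
  [set x0 | exists a : R -> 'rV[R]_m, admissible_control a /\
     exists tau : R, 0 <= tau < t /\
     exists x : R -> 'rV[R]_n, solution_on sigma a x0 tau x /\ u (x tau) <= u xbar].

Definition STLA (n m : nat) (sigma : 'I_m -> 'rV[R]_n -> 'rV[R]_n)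
  (u : 'rV[R]_n -> R) (xbar : 'rV[R]_n) : Prop :=
  forall t : R, 0 < t -> interior (reach_set sigma u xbar t) xbar.

End Defs.

(* Main.v *)
Require Import Defs.
From HB Require Import structures.
From mathcomp Require Import all_boot all_order all_algebra.
From mathcomp Require Import all_classical all_reals all_analysis.
From mathcomp Require Import ring lra.
Set Implicit Arguments. Unset Strict Implicit. Unset Printing Implicit Defensive.
Import Order.TTheory GRing.Theory Num.Theory.
Import numFieldNormedType.Exports.
Local Open Scope classical_set_scope.
Local Open Scope ring_scope.

(* Write L_f h for the derivative of h along f, and put f = sigma a1, g = sigma a2.
   Following f for time s and then g for time s from y, the mean value theorem and
   second-order Taylor expansions along the two arcs give
     u(end) <= u(y) + s (L_f u + L_g u)(y)
               + s^2/2 (L_f L_f u + 2 L_f L_g u + L_g L_g u + small),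
   where the second-order terms are evaluated near xbar. By symmetry of the Hessian
   the bracket at xbar is
     Tr(D^2u (f+g) (x) (f+g)) + (D(f+g)(f+g) + [f, g]) . grad u < 0.
   Replacing (a1, a2) by (-a1, -a2) leaves the bracket unchanged and flips the
   first-order term, so for every y near xbar one of the two choices gains a fixed
   multiple of s^2, which exceeds u(y) - u(xbar) once y is close enough to xbar.
   The arcs come from a Picard iteration. *)

(** * Differential calculus on row vectors *)

Section RowVectorNorm.
Variables (R : realType) (n : nat).
Implicit Types x y v : 'rV[R]_n.

Lemma coord_le_norm v i : `|v ord0 i| <= `|v|.
Proof.
by rewrite [leRHS]/Num.Def.normr/= mx_normrE; exact: (le_bigmax _ _ (ord0, i)).
Qed.

Lemma norm_rV_le v (e : R) : 0 <= e -> (forall i, `|v ord0 i| <= e) -> `|v| <= e.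
Proof.
move=> e0 ve; rewrite /Num.Def.normr/= mx_normrE (bigmax_le _ e0)//= => -[i j] _.
by rewrite ord1.
Qed.

End RowVectorNorm.

(** * One-variable mean value and Taylor inequalities *)

Section OneVariable.
Variable R : realType.

(** The difference quotient of the restriction to the line is the directional quotient of [f], so
    one-variable results apply to [f] along lines. *)
Lemma is_derive_line (V W : normedModType R) (f : V -> W) (y v : V) (t : R) :
  derivable f (y + t *: v) v ->
  is_derive t 1 (fun s => f (y + s *: v)) ('D_v f (y + t *: v)).
Proof.
have E : (fun h => h^-1 *: (((fun s => f (y + s *: v)) \o shift t) (h *: 1) - f (y + t *: v)))
   = (fun h => h^-1 *: ((f \o shift (y + t *: v)) (h *: v) - f (y + t *: v))) :> (R -> W).
  apply/funext => h /=; congr (_ *: (f _ - _)).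
  by rewrite [h *: 1]mulr1 scalerDl addrCA.
by move=> d; apply: DeriveDef; rewrite /derivable /derive E.
Qed.

Lemma MVT_closed (f df : R -> R) (a b : R) : a <= b ->
  (forall x : R, a <= x <= b -> is_derive x 1 f (df x)) ->
  exists2 c, a <= c <= b & f b - f a = df c * (b - a).
Proof.
move=> ab fd; have [||c] := @MVT_segment R f df a b ab.
- by move=> x; rewrite in_itv/= => /andP[/ltW ax /ltW xb]; apply: fd; rewrite ax.
- apply: derivable_within_continuous => x; rewrite in_itv/= => xab.
  by have [] := fd x xab.
- by rewrite in_itv/= => cab E; exists c.
Qed.

Lemma MVT_dist (f df : R -> R) (a b : R) :
  (forall x : R, is_derive x 1 f (df x)) ->
  exists2 c, `|c - a| <= `|b - a| & f b - f a = df c * (b - a).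
Proof.
move=> fd; have [ab|/ltW ba] := leP a b.
  have [c /andP[ac cb] E] := MVT_closed ab (fun x _ => fd x).
  exists c => //; rewrite !ger0_norm ?subr_ge0//; lra.
have [c /andP[ac cb] E] := MVT_closed ba (fun x _ => fd x).
exists c; last by lra.
by rewrite !ler0_norm ?subr_le0//; lra.
Qed.

Lemma derive_le_increment (f df : R -> R) (K a b : R) : a <= b ->
  (forall x : R, a <= x <= b -> is_derive x 1 f (df x)) ->
  (forall x, a <= x <= b -> df x <= K) ->
  f b <= f a + K * (b - a).
Proof.
move=> ab fd fK; have [c cab E] := MVT_closed ab fd.
have := fK _ cab => dK.
have : df c * (b - a) <= K * (b - a) by rewrite ler_wpM2r// subr_ge0.
lra.
Qed.

(** Integrate the bound on [p2] twice: the first time gives an affine bound on [p1]; the second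
    compares [p] with the antiderivative of that affine bound, their difference [q] having
    nonpositive derivative. *)
Lemma taylor2_le (p p1 p2 : R -> R) (K s : R) : 0 <= s ->
  (forall t : R, 0 <= t <= s -> is_derive t 1 p (p1 t)) ->
  (forall t : R, 0 <= t <= s -> is_derive t 1 p1 (p2 t)) ->
  (forall t, 0 <= t <= s -> p2 t <= K) ->
  p s <= p 0 + s * p1 0 + s ^+ 2 / 2 * K.
Proof.
move=> s0 dp dp1 p2K.
have p1K t : 0 <= t <= s -> p1 t <= p1 0 + K * t.
  move=> /andP[t0 ts]; have := @derive_le_increment p1 p2 K 0 t t0.
  rewrite subr0; apply=> r /andP[r0 rt]; [apply: dp1|apply: p2K];
  by rewrite r0 (le_trans rt).
pose q := fun t => p t - (t * p1 0 + K / 2 * (t * t)).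
suff dq (t : R) : 0 <= t <= s -> is_derive t 1 q (p1 t - (p1 0 + K * t)).
  have := @derive_le_increment q (fun t => p1 t - (p1 0 + K * t)) 0 0 s s0 dq.
  rewrite /q expr2 => /(_ _)/wrap[t ts|]; last by lra.
  by rewrite subr_le0; exact: p1K.
move=> ts; have dpt := dp t ts.
apply: is_derive_eq.
rewrite /GRing.scale/=; lra.
Qed.

End OneVariable.

Lemma continuous_sum (R : realType) (T : topologicalType) (V : normedModType R)
    (n : nat) (f : 'I_n -> T -> V) :
  (forall i, continuous (f i)) -> continuous (fun x => \sum_(i < n) f i x).
Proof. by move=> cf; apply: continuous_big => [|i _]; [exact: add_continuous|exact: cf]. Qed.

Lemma continuous_mul (R : realType) (T : topologicalType) (f g : T -> R) :
  continuous f -> continuous g -> continuous (fun x => f x * g x).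
Proof. by move=> cf cg x; apply: cvgM; [exact: cf|exact: cg]. Qed.

Lemma continuous_add (R : realType) (T : topologicalType) (V : normedModType R)
    (f g : T -> V) :
  continuous f -> continuous g -> continuous (fun x => f x + g x).
Proof. by move=> cf cg x; apply: cvgD; [exact: cf|exact: cg]. Qed.

Lemma continuous_scale (R : realType) (T : topologicalType) (V : normedModType R)
    (c : R) (f : T -> V) : continuous f -> continuous (fun x => c *: f x).
Proof. by move=> cf x; apply: cvgZl_tmp; exact: cf. Qed.

(** Epsilon form of Fréchet differentiability; uniqueness of the differential identifies it with
    [df]. *)
Lemma is_diff_increment (R : realType) (V W : normedModType R) (f : V -> W)
    (df : {linear V -> W}) (x : V) :
  continuous df ->
  (forall e : R, 0 < e ->
    \forall v \near (0 : V), `|f (x + v) - f x - df v| <= e * `|v|) ->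
  is_diff x f df.
Proof.
move=> cdf fe.
have o : f \o shift x = cst (f x) + df +o_ 0 id.
  apply/eqaddoP => e e0; have := fe e e0; apply: filterS => v.
  suff -> : (f \o shift x - (cst (f x) + df)) v = f (x + v) - f x - df v by [].
  by rewrite -![(_ + _ : _ -> _) _]/(_ + _) -![(- _ : _ -> _) _]/(- _) /= opprD addrA [x + v]addrC.
have D := diff_unique cdf o.
by apply: DiffDef => //; apply/diff_locallyP; rewrite D.
Qed.

(** * Differentiability from continuous partials, and the chain rule along curves *)

Section Differentiability.
Variables (R : realType) (n : nat).
Implicit Types (x y v : 'rV[R]_n) (h : 'rV[R]_n -> R).

Lemma MVT_partial h j y (t : R) : (forall z, derivable h z (evec R j)) ->
  exists2 c, `|c| <= `|t| &
    h (y + t *: evec R j) - h y = t * partial j h (y + c *: evec R j).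
Proof.
move=> dh.
have [|c] := @MVT_dist R (fun s => h (y + s *: evec R j))
  (fun s => partial j h (y + s *: evec R j)) 0 t.
  by move=> s; exact: is_derive_line.
by rewrite !subr0 scale0r addr0 mulrC => ct ->; exists c.
Qed.

(* Moving from [x] to [x + v] one coordinate at a time: [trunc_rV v k] keeps the
   first [k] coordinates of [v]. *)
Definition trunc_rV (v : 'rV[R]_n) (k : nat) : 'rV[R]_n :=
  \row_(j < n) (if (j < k)%N then v ord0 j else 0).

Lemma trunc_rV0 v : trunc_rV v 0 = 0.
Proof. by apply/rowP => j; rewrite !mxE. Qed.

Lemma trunc_rV_full v : trunc_rV v n = v.
Proof. by apply/rowP => j; rewrite !mxE ltn_ord. Qed.

Lemma trunc_rVS v (k : 'I_n) :
  trunc_rV v k.+1 = trunc_rV v k + v ord0 k *: evec R k.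
Proof.
apply/rowP => j; rewrite !mxE /= ltnS -val_eqE/=.
by case: ltngtP => [|_|/val_inj ->]; rewrite ?(mulr0, mulr1, addr0, add0r).
Qed.

Lemma trunc_rV_line_norm v (k : 'I_n) (c : R) : `|c| <= `|v ord0 k| ->
  `|trunc_rV v k + c *: evec R k| <= `|v|.
Proof.
move=> ck; apply: norm_rV_le => // j; rewrite !mxE/= -val_eqE/=.
case: ltngtP => _; rewrite ?(mulr0, mulr1, addr0, add0r) ?normr0//.
  exact: coord_le_norm.
by rewrite (le_trans ck)// coord_le_norm.
Qed.

(** Telescope over the path that adds one coordinate of [v] at a time and apply the mean value
    theorem to each step. In the sup norm every intermediate point is within [|v|] of [x], so
    continuity of the partials controls all steps at once. *)
Lemma partial_increment_le h x (e : R) : 0 < e ->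
  (forall j z, derivable h z (evec R j)) ->
  (forall j, {for x, continuous (partial j h)}) ->
  \forall v \near (0 : 'rV[R]_n),
    `|h (x + v) - h x - \sum_(j < n) v ord0 j * partial j h x| <= e * `|v|.
Proof.
move=> e0 dh ch.
(* Each of the [n] coordinates receives this share of the error; [n.+1] keeps the quotient
   meaningful for [n = 0]. *)
have en0 : 0 < e / n.+1%:R by rewrite divr_gt0.
have N : \forall v \near (0 : 'rV[R]_n), forall j : 'I_n,
    `|partial j h x - partial j h (x + v)| <= e / n.+1%:R.
  have := (@filter_forall 'rV[R]_n 'I_n (fun j v =>
    `|partial j h x - partial j h (x + v)| <= e / n.+1%:R) (nbhs (0 : 'rV[R]_n)) _).
  apply => j; have /cvgrPdist_le/(_ _ en0)/nbhs_ballP[d /= d0 Hd] := ch j.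
  apply/nbhs_ballP; exists d => //= v; rewrite -ball_normE/= sub0r normrN => vd.
  by apply: Hd; rewrite -ball_normE/= opprD addrA subrr sub0r normrN.
have /nbhs_ballP[d /= d0 Hd] := N.
apply/nbhs_ballP; exists d => //= v; rewrite -ball_normE/= sub0r normrN => vd.
have E : h (x + v) - h x =
    \sum_(k < n) (h (x + trunc_rV v k.+1) - h (x + trunc_rV v k)).
  rewrite -(big_mkord xpredT (fun k => h (x + trunc_rV v k.+1) - h (x + trunc_rV v k))).
  by rewrite telescope_sumr// trunc_rV0 addr0 trunc_rV_full.
rewrite E -sumrB (le_trans (ler_norm_sum _ _ _))//.
apply: (@le_trans _ _ (\sum_(k < n) e / n.+1%:R * `|v|)).
  apply: ler_sum => k _.
  rewrite trunc_rVS addrA.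
  have [c ck ->] := MVT_partial (x + trunc_rV v k) (v ord0 k) (dh k).
  rewrite -mulrBr normrM mulrC ler_pM ?coord_le_norm// distrC -addrA.
  apply: Hd; rewrite -ball_normE/= sub0r normrN.
  by rewrite (le_lt_trans _ vd)// trunc_rV_line_norm.
rewrite sumr_const card_ord -mulrnAl ler_wpM2r// -mulr_natr -mulrA ler_piMr ?ltW//.
by rewrite mulrC ltr_pdivrMr// mul1r ltr_nat.
Qed.

Definition grad_form h x (v : 'rV[R]_n) : R := \sum_(j < n) v ord0 j * partial j h x.

Lemma grad_form_linear h x : linear (grad_form h x).
Proof.
move=> a v w; rewrite /grad_form scaler_sumr -big_split/=; apply: eq_bigr => j _.
by rewrite !mxE mulrDl -mulrA.
Qed.

HB.instance Definition _ h x :=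
  GRing.isLinear.Build R 'rV[R]_n R _ (grad_form h x) (grad_form_linear h x).

Lemma is_diff_partial h x :
  (forall j z, derivable h z (evec R j)) ->
  (forall j, {for x, continuous (partial j h)}) ->
  is_diff x h (grad_form h x).
Proof.
move=> dh ch.
have cg : continuous (grad_form h x).
  apply: continuous_sum => j.
  by apply: continuous_mul; [exact: coord_continuous|exact: cst_continuous].
apply: is_diff_increment => // e e0; exact: partial_increment_le.
Qed.

Lemma is_derive_comp_partial h (w : R -> 'rV[R]_n) (t : R) (dw : 'rV[R]_n) :
  Ck 1 h -> is_derive t 1 w dw ->
  is_derive t 1 (h \o w) (\sum_(j < n) partial j h (w t) * dw ord0 j).
Proof.
move=> [_ [dh ch]] [dwt wE].
have dw' : differentiable w t by apply/derivable1_diffP.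
have [dhx hE] := is_diff_partial dh (fun j => ch j (w t)).
have dc : differentiable (h \o w) t by exact: differentiable_comp.
apply: DeriveDef; first exact/derivable1_diffP.
rewrite deriveE// diff_comp//= hE -deriveE// wE /grad_form.
by apply: eq_bigr => j _; rewrite mulrC.
Qed.

End Differentiability.

(** * Calculus of [Ck] functions and symmetry of second partials *)

Section ContinuouslyDifferentiable.
Variables (R : realType) (n : nat).
Implicit Types (x y v : 'rV[R]_n) (h : 'rV[R]_n -> R).

Lemma CkS_Ck (W : normedModType R) k (f : 'rV[R]_n -> W) : Ck k.+1 f -> Ck k f.
Proof.
elim: k f => [|k IH] f [cf [df pf]]; first exact: cf.
by split=> //; split=> // j; exact: IH.
Qed.

Lemma partialD (W : normedModType R) j (f g : 'rV[R]_n -> W) : Ck 1 f -> Ck 1 g ->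
  partial j (fun x => f x + g x) = (fun x => partial j f x + partial j g x).
Proof. by move=> [_ [df _]] [_ [dg _]]; apply/funext => x; exact: deriveD. Qed.

Lemma partialM j (f g : 'rV[R]_n -> R) : Ck 1 f -> Ck 1 g ->
  partial j (fun x => f x * g x) = (fun x => partial j f x * g x + f x * partial j g x).
Proof.
move=> [_ [df _]] [_ [dg _]]; apply/funext => x.
rewrite /partial deriveM; [|exact: df|exact: dg].
by rewrite addrC; congr (_ + _); exact: mulrC.
Qed.

Lemma partial_sum (W : normedModType R) j p (f : 'I_p -> 'rV[R]_n -> W) : (forall i, Ck 1 (f i)) ->
  partial j (fun x => \sum_(i < p) f i x) = (fun x => \sum_(i < p) partial j (f i) x).
Proof.
move=> Cf; apply/funext => x; rewrite /partial.
have -> : (fun x => \sum_(i < p) f i x) = \sum_(i < p) f i.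
  by apply/funext => y; rewrite fct_sumE.
by rewrite derive_sum// => i; case: (Cf i) => _ [].
Qed.

Lemma Ck1M (f g : 'rV[R]_n -> R) : Ck 1 f -> Ck 1 g -> Ck 1 (fun x => f x * g x).
Proof.
move=> Cf Cg; have [cf [df pf]] := Cf; have [cg [dg pg]] := Cg.
split; first exact: continuous_mul.
split=> [j x|j]; first exact: derivableM.
by rewrite partialM//; apply: continuous_add; apply: continuous_mul.
Qed.

Lemma Ck1_sum (W : normedModType R) p (f : 'I_p -> 'rV[R]_n -> W) : (forall i, Ck 1 (f i)) ->
  Ck 1 (fun x => \sum_(i < p) f i x).
Proof.
move=> Cf; split; first by apply: continuous_sum => i; case: (Cf i).
split=> [j x|j].
  have -> : (fun x => \sum_(i < p) f i x) = \sum_(i < p) f i.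
    by apply/funext => y; rewrite fct_sumE.
  by apply: derivable_sum => i; case: (Cf i) => _ [].
by rewrite partial_sum//; apply: continuous_sum => i; case: (Cf i) => _ [].
Qed.

Lemma Ck1Z (W : normedModType R) (c : R) (f : 'rV[R]_n -> W) : Ck 1 f -> Ck 1 (fun x => c *: f x).
Proof.
move=> [cf [df pf]]; split; first exact: continuous_scale.
split=> [j x|j]; first exact: derivableZ.
have -> : partial j (fun x => c *: f x) = (fun x => c *: partial j f x).
  by apply/funext => x; exact: deriveZ.
exact: continuous_scale.
Qed.

Lemma partial_coord m j (f : 'rV[R]_n -> 'rV[R]_m) k : Ck 1 f ->
  partial j (fun x => f x ord0 k) = (fun x => partial j f x ord0 k).
Proof.
move=> [_ [df _]]; apply/funext => x.
by rewrite /partial (derive_mx (df j x)) mxE.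
Qed.

Lemma Ck1_coord m (f : 'rV[R]_n -> 'rV[R]_m) k : Ck 1 f -> Ck 1 (fun x => f x ord0 k).
Proof.
move=> Cf; have [cf [df pf]] := Cf.
have cc (g : 'rV[R]_n -> 'rV[R]_m) : continuous g -> continuous (fun x => g x ord0 k).
  by move=> cg x; exact: (continuous_comp (cg x) (@coord_continuous _ _ _ ord0 k (g x))).
split; first exact: cc.
split=> [j x|j]; first by have /derivable_mxP := df j x; exact.
by rewrite partial_coord//; exact/cc/pf.
Qed.

(* Symmetry of second partials: the same second difference is [s ^+ 2] times
   either mixed partial at points tending to [x]. *)
Lemma second_difference h i j x (s : R) : Ck 2 h ->
  exists c : R, exists d : R, [/\ `|c| <= `|s|, `|d| <= `|s| &
    h (x + s *: evec R i + s *: evec R j) - h (x + s *: evec R i)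
      - (h (x + s *: evec R j) - h x) =
    s * (s * partial j (partial i h) (x + c *: evec R i + d *: evec R j))].
Proof.
move=> [_ [dh ph]]; have [_ [dph _]] := ph i.
pose F t := h (x + s *: evec R j + t *: evec R i) - h (x + t *: evec R i).
pose dF t := partial i h (x + s *: evec R j + t *: evec R i) - partial i h (x + t *: evec R i).
have FD (t : R) : is_derive t 1 F (dF t).
  by apply: is_deriveB; apply: is_derive_line.
have [c] := MVT_dist 0 s FD.
rewrite !subr0 => cs E.
have [d ds E'] := MVT_partial (x + c *: evec R i) s (dph j).
exists c, d; split=> //; rewrite -E'.
move: E; rewrite /F /dF !scale0r !addr0 mulrC.
by rewrite ![_ + _ *: evec R j + _]addrAC.
Qed.

Lemma dist_le_half (p q r e : R) :
  `|p - r| <= e / 2 -> `|q - r| <= e / 2 -> `|p - q| <= e.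
Proof. by rewrite !ler_norml; lra. Qed.

Lemma norm_evec_le (j : 'I_n) : `|evec R j| <= 1.
Proof.
apply: norm_rV_le => // i; rewrite !mxE/=.
by case: eqP => _; rewrite ?normr1 ?normr0.
Qed.

(** Schwarz's theorem: the second difference does not depend on the order of [i] and [j], so after
    cancelling [s] twice the two mixed partials agree at points close to [x]; continuity brings both
    within [e / 2] of their values at [x]. *)
Lemma partialC h i j x : Ck 2 h ->
  partial i (partial j h) x = partial j (partial i h) x.
Proof.
move=> Ch; have [_ [dh ph]] := Ch.
apply/eqP; rewrite -subr_eq0 -normr_le0; apply/ler_addgt0Pr => e e0.
have e20 : 0 < e / 2 by lra.
have ci : {for x, continuous (partial i (partial j h))} by have [_ [_]] := ph j; apply.
have cj : {for x, continuous (partial j (partial i h))} by have [_ [_]] := ph i; apply.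
have /cvgrPdist_le/(_ _ e20)/nbhs_ballP[d1 /= d10 H1] := ci.
have /cvgrPdist_le/(_ _ e20)/nbhs_ballP[d2 /= d20 H2] := cj.
(* A displacement by at most [s] along each of two basis vectors then stays inside both continuity
   balls. *)
pose s := Num.min d1 d2 / 4.
have m0 : 0 < Num.min d1 d2 by rewrite lt_min d10.
have s0 : 0 < s by rewrite divr_gt0.
have near_x (c d : R) k l : `|c| <= `|s| -> `|d| <= `|s| ->
    `|x - (x + c *: evec R k + d *: evec R l)| < Num.min d1 d2.
  move=> cs ds; rewrite -addrA opprD addrA subrr sub0r normrN.
  rewrite (le_lt_trans (ler_normD _ _))// !normrZ.
  have ek := norm_evec_le k; have el := norm_evec_le l.
  have : `|c| * `|evec R k| <= s by rewrite -[leRHS]mulr1 ler_pM// -(gtr0_norm s0).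
  have : `|d| * `|evec R l| <= s by rewrite -[leRHS]mulr1 ler_pM// -(gtr0_norm s0).
  rewrite /s; lra.
have [c [d [cs ds E]]] := second_difference i j x s Ch.
have [c' [d' [cs' ds' E']]] := second_difference j i x s Ch.
have : partial j (partial i h) (x + c *: evec R i + d *: evec R j) =
       partial i (partial j h) (x + c' *: evec R j + d' *: evec R i).
  apply: (mulfI (lt0r_neq0 s0)); apply: (mulfI (lt0r_neq0 s0)).
  apply: etrans (esym E) (etrans _ E'); rewrite [x + s *: evec R j + s *: evec R i]addrAC.
  move: (h (x + s *: evec R i + s *: evec R j)) (h (x + s *: evec R i)) => p q.
  by move: (h (x + s *: evec R j)) (h x) => p' q'; ring.
have h1 := H1 (x + c' *: evec R j + d' *: evec R i).
have h2 := H2 (x + c *: evec R i + d *: evec R j).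
move: h1 h2; rewrite -!ball_normE/= => h1 h2 EE.
have := near_x _ _ j i cs' ds'; rewrite lt_min => /andP[/h1{}h1 _].
have := near_x _ _ i j cs ds; rewrite lt_min => /andP[_ /h2{}h2].
by rewrite add0r; apply: dist_le_half h1 _; rewrite -EE.
Qed.

End ContinuouslyDifferentiable.

(** * Iterated Lie derivatives and the second-order bracket *)

Section LieDerivative.
Variables (R : realType) (n : nat).
Implicit Types (A B : 'M[R]_n) (x v w : 'rV[R]_n) (f g : 'rV[R]_n -> 'rV[R]_n) (h u : 'rV[R]_n -> R).

Definition lie_derivative f h x : R := \sum_(j < n) partial j h x * f x ord0 j.

Lemma continuous_lie_derivative f h : continuous f -> Ck 1 h ->
  continuous (lie_derivative f h).
Proof.
move=> cf [_ [_ ph]]; apply: continuous_sum => j; apply: continuous_mul => // x.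
exact: (continuous_comp (cf x) (@coord_continuous _ _ _ ord0 j (f x))).
Qed.

Lemma Ck1_lie_derivative f h : Ck 1 f -> Ck 2 h -> Ck 1 (lie_derivative f h).
Proof.
move=> Cf [_ [_ ph]]; apply: Ck1_sum => j; apply: Ck1M; first exact: ph.
exact: Ck1_coord.
Qed.

Lemma is_derive_along f h (w : R -> 'rV[R]_n) (t : R) : Ck 1 h ->
  is_derive t 1 w (f (w t)) -> is_derive t 1 (h \o w) (lie_derivative f h (w t)).
Proof. exact: is_derive_comp_partial. Qed.

(** The bilinear form behind [trvv], introduced to separate the cross terms between two vector
    fields. *)
Definition quadratic_form (A : 'M[R]_n) v w : R :=
  \sum_(i < n) \sum_(j < n) A i j * (v ord0 i * w ord0 j).

Lemma quadratic_formDl A v v' w :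
  quadratic_form A (v + v') w = quadratic_form A v w + quadratic_form A v' w.
Proof.
rewrite /quadratic_form -big_split/=; apply: eq_bigr => i _.
rewrite -big_split/=; apply: eq_bigr => j _; rewrite !mxE; ring.
Qed.

Lemma quadratic_formC A v w : (forall i j, A i j = A j i) ->
  quadratic_form A v w = quadratic_form A w v.
Proof.
move=> As; rewrite /quadratic_form exchange_big/=; apply: eq_bigr => i _.
by apply: eq_bigr => j _; rewrite As [v _ _ * _]mulrC.
Qed.

Lemma trvv_quadratic_form A v : trvv A v = quadratic_form A v v.
Proof.
rewrite /trvv /mxtrace /quadratic_form; apply: eq_bigr => i _; rewrite mxE.
by apply: eq_bigr => j _; rewrite !mxE big_ord1 !mxE [v _ _ * _]mulrC.
Qed.

Lemma dotvDl (v w z : 'rV[R]_n) : dotv (v + w) z = dotv v z + dotv w z.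
Proof. by rewrite /dotv -big_split/=; apply: eq_bigr => i _; rewrite mxE mulrDl. Qed.

Lemma dotvNl (v z : 'rV[R]_n) : dotv (- v) z = - dotv v z.
Proof. by rewrite /dotv -sumrN; apply: eq_bigr => i _; rewrite mxE mulNr. Qed.

Lemma mxappDl A B v : mxapp (A + B) v = mxapp A v + mxapp B v :> 'rV[R]_n.
Proof. by rewrite /mxapp mulmxDl linearD. Qed.

Lemma mxappDr A v w : mxapp A (v + w) = mxapp A v + mxapp A w :> 'rV[R]_n.
Proof. by rewrite /mxapp linearD mulmxDr linearD. Qed.

Lemma jacD f g x : Ck 1 f -> Ck 1 g ->
  jac (fun y => f y + g y) x = jac f x + jac g x.
Proof. by move=> Cf Cg; apply/matrixP => i j; rewrite !mxE partialD// mxE. Qed.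

(** Product rule on the sum defining [lie_derivative g u]: differentiating the partials of [u] gives
    the Hessian term, differentiating the components of [g] gives the Jacobian term. *)
Lemma lie_derivative2E f g u x : Ck 1 g -> Ck 2 u ->
  lie_derivative f (lie_derivative g u) x =
  quadratic_form (hess u x) (f x) (g x) + dotv (mxapp (jac g x) (f x)) (grad u x).
Proof.
move=> Cg Cu; have [_ [_ pu]] := Cu.
have E i : partial i (lie_derivative g u) x * f x ord0 i =
    \sum_(j < n) hess u x i j * (f x ord0 i * g x ord0 j)
    + \sum_(j < n) (jac g x j i * f x ord0 i) * grad u x ord0 j.
  rewrite /lie_derivative partial_sum; last first.
    by move=> j; apply: Ck1M; [exact: pu|exact: Ck1_coord].
  rewrite mulr_suml -big_split/=; apply: eq_bigr => j _.
  rewrite partialM; [|exact: pu|exact: Ck1_coord].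
  rewrite partial_coord// !mxE; ring.
rewrite {1}/lie_derivative (eq_bigr _ (fun i _ => E i)) big_split/=; congr (_ + _).
rewrite exchange_big/=; apply: eq_bigr => j _; rewrite -mulr_suml; congr (_ * _).
by rewrite !mxE; apply: eq_bigr => i _; rewrite [(f x)^T _ _]mxE.
Qed.

(** The Hessian terms form a complete square by symmetry. For the gradient terms, Df f + 2 Dg f + Dg
    g equals D(f+g)(f+g) + (Dg f - Df g), which is where the Lie bracket enters. *)
Lemma second_order_bracket f g u x : Ck 1 f -> Ck 1 g -> Ck 2 u ->
  lie_derivative f (lie_derivative f u) x
  + 2 * lie_derivative f (lie_derivative g u) x
  + lie_derivative g (lie_derivative g u) x =
  trvv (hess u x) (f x + g x)
  + dotv (mxapp (jac (fun y => f y + g y) x) (f x + g x) + lie f g x) (grad u x).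
Proof.
move=> Cf Cg Cu; rewrite !lie_derivative2E// trvv_quadratic_form.
have HC := quadratic_formC (A := hess u x).
have {}HC v w := HC v w (fun i j => ltac:(rewrite !mxE; exact: partialC)).
rewrite quadratic_formDl ![quadratic_form _ _ (f x + g x)]HC !quadratic_formDl.
rewrite [quadratic_form _ (g x) (f x)]HC /lie jacD// !mxappDr !mxappDl !dotvDl dotvNl.
have collect (q1 q2 q3 dff dgf dfg dgg : R) :
    q1 + dff + 2 * (q2 + dgf) + (q3 + dgg) =
    q1 + q2 + (q2 + q3) + (dff + dgf + (dfg + dgg) + (dgf - dfg)) by clear; ring.
exact: collect.
Qed.

End LieDerivative.

(** * Existence of integral curves *)

Section Geometric.
Variable R : realType.

(** Archimedean passage to the limit: were [a > b], some power of 2 would exceed [D / (a - b)]. It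
    transfers estimates on the Picard iterates to their limit. *)
Lemma le_geometric (a b D : R) : (forall k : nat, a <= b + D / 2 ^+ k) -> a <= b.
Proof.
move=> H; rewrite leNgt; apply/negP => ba.
have D0 : 0 < D by move: (H 0%N); rewrite expr0 divr1; lra.
pose k := Num.bound (D / (a - b)).
have ab : 0 < a - b by lra.
have k1 : D / (a - b) < k%:R.
  by apply: archi_boundP; rewrite divr_ge0// ltW.
have k2 : k%:R < 2 ^+ k :> R by rewrite -natrX ltr_nat ltn_expl.
have k20 : (0 : R) < 2 ^+ k by rewrite exprn_gt0.
have : D / 2 ^+ k < a - b.
  by rewrite ltr_pdivrMr// mulrC -ltr_pdivrMr// (lt_trans k1).
move: (H k); lra.
Qed.

Lemma geometric_cvg (a : nat -> R) (C : R) : 0 <= C ->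
  (forall k, `|a k.+1 - a k| <= C / 2 ^+ k) ->
  exists l, forall k, `|a k - l| <= 2 * C / 2 ^+ k.
Proof.
move=> C0 aC.
(* The brackets [b k, c k] around [a k] are nested, so they share a point. *)
pose b k := a k - 2 * C / 2 ^+ k; pose c k := a k + 2 * C / 2 ^+ k.
have half k : 2 * C / 2 ^+ k.+1 = C / 2 ^+ k.
  by rewrite exprS invfM mulrACA divff ?mul1r.
have dbl k : 2 * C / 2 ^+ k = 2 * (C / 2 ^+ k) by rewrite mulrA.
have b_nd : nondecreasing_seq b.
  apply/nondecreasing_seqP => k; move: (aC k); rewrite /b half dbl ler_norml.
  by move: (C / 2 ^+ k) (a k) (a k.+1) => r p q; clear; lra.
have c_ni : nonincreasing_seq c.
  apply/nonincreasing_seqP => k; move: (aC k); rewrite /c half dbl ler_norml.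
  by move: (C / 2 ^+ k) (a k) (a k.+1) => r p q; clear; lra.
have bc i j : b i <= c j.
  have bck k : b k <= c k.
    have : 0 <= 2 * C / 2 ^+ k by rewrite divr_ge0// ?mulr_ge0// exprn_ge0.
    by rewrite /b /c; move: (2 * C / 2 ^+ k) => r; clear; lra.
  apply: (le_trans (b_nd _ _ (leq_maxl i j))).
  by apply: (le_trans (bck _)); apply: c_ni; exact: leq_maxr.
exists (sup (range b)) => k.
have b_ub : has_ubound (range b) by exists (c 0%N) => _ [i _ <-].
have b_le : b k <= sup (range b) by apply: ub_le_sup => //; exists k.
have c_ge : sup (range b) <= c k.
  by apply: ge_sup; [exists (b 0%N), 0%N|move=> _ [i _ <-]].
move: b_le c_ge; rewrite /b /c ler_norml.
by move: (sup _) (2 * C / _) (a k) => p q r; clear; lra.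
Qed.

Lemma geometric_cvg_rV n (a : nat -> 'rV[R]_n) (C : R) : 0 <= C ->
  (forall k, `|a k.+1 - a k| <= C / 2 ^+ k) ->
  exists l, forall k, `|a k - l| <= 2 * C / 2 ^+ k.
Proof.
move=> C0 aC.
have /choice[l lP] (i : 'I_n) :
    exists l, forall k, `|a k ord0 i - l| <= 2 * C / 2 ^+ k.
  apply: geometric_cvg => // k; apply: le_trans (aC k).
  by apply: le_trans (coord_le_norm _ i); rewrite !mxE.
exists (\row_i l i) => k; apply: norm_rV_le => [|i].
  by rewrite divr_ge0// ?mulr_ge0// exprn_ge0.
by rewrite !mxE.
Qed.

End Geometric.

(** * Mean value inequalities and antiderivatives for vector-valued curves *)

Section VectorCurves.
Variables (R : realType) (n : nat).
Implicit Types w : R -> 'rV[R]_n.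

Lemma lipschitz_continuous_curve (V : normedModType R) (w : R -> V) (K : R) :
  (forall s t, `|w s - w t| <= K * `|s - t|) -> continuous w.
Proof.
move=> wK s; apply/cvgrPdist_le => e e0.
have K0 : 0 < `|K| + 1 by rewrite ltr_pwDr.
apply/nbhs_ballP; exists (e / (`|K| + 1)) => /=; first exact: divr_gt0.
move=> t /= st.
apply: (le_trans (wK s t)); apply: (@le_trans _ _ ((`|K| + 1) * `|s - t|)).
  by rewrite ler_wpM2r// (le_trans (ler_norm K))// lerDl.
by rewrite mulrC -ler_pdivlMr// ltW.
Qed.

Lemma is_derive_rVP w (t : R) (d : 'rV[R]_n) :
  is_derive t 1 w d <-> forall k, is_derive t 1 (fun s => w s ord0 k) (d ord0 k).
Proof.
split=> [[dw <-] k|H].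
  split; first by have /derivable_mxP := dw; exact.
  by rewrite (derive_mx dw) mxE.
have dw : derivable w t 1 by apply/derivable_mxP => i k; rewrite ord1; case: (H k).
split=> //; rewrite (derive_mx dw); apply/rowP => k; rewrite mxE.
by case: (H k).
Qed.

(** The mean value theorem is applied to each coordinate; the intermediate times differ, but the
    bound [K] is common and the norm is a maximum over coordinates. *)
Lemma mean_value_le w (dw : R -> 'rV[R]_n) (K a b : R) : a <= b ->
  (forall t : R, a <= t <= b -> is_derive t 1 w (dw t)) ->
  (forall t, a <= t <= b -> `|dw t| <= K) ->
  `|w b - w a| <= K * (b - a).
Proof.
move=> ab wd wK; have K0 : 0 <= K by rewrite (le_trans _ (wK a _))// lexx.
apply: norm_rV_le => [|k]; first by rewrite mulr_ge0// subr_ge0.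
have [t tab] := @MVT_closed R (fun s => w s ord0 k) (fun s => dw s ord0 k) a b ab
  (fun t tab => (is_derive_rVP w t (dw t)).1 (wd t tab) k).
rewrite !mxE => ->; rewrite normrM (ger0_norm (_ : 0 <= b - a)) ?subr_ge0//.
by rewrite ler_wpM2r ?subr_ge0// (le_trans (coord_le_norm _ _))// wK.
Qed.

Lemma mean_value_norm_le w (dw : R -> 'rV[R]_n) (K a b T : R) :
  (forall t : R, `|t| <= T -> is_derive t 1 w (dw t)) ->
  (forall t, `|t| <= T -> `|dw t| <= K) ->
  `|a| <= T -> `|b| <= T -> `|w b - w a| <= K * `|b - a|.
Proof.
wlog ab : a b / a <= b => [H wd wK aT bT|].
  have [/H|/ltW/H] := leP a b; first exact.
  by rewrite distrC [`|b - a|]distrC; exact.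
move=> wd wK aT bT; rewrite (ger0_norm (_ : 0 <= b - a)) ?subr_ge0//.
have tT t : a <= t <= b -> `|t| <= T.
  by move: aT bT; rewrite !ler_norml; clear; lra.
by apply: mean_value_le => // t tab; [apply: wd|apply: wK]; exact: tT.
Qed.

(** The integral from -1, adjusted by a constant. Fixing the interval (-1, 1) is why the Picard time
    is taken below 1. *)
Lemma antiderivative (g : R -> R) (c : R) : continuous g ->
  exists2 G : R -> R, G 0 = c & forall t : R, `|t| < 1 -> is_derive t 1 G (g t).
Proof.
move=> cg.
have gi : (@lebesgue_measure R).-integrable `[(-1), 1] (EFin \o g).
  apply: continuous_compact_integrable; first exact: segment_compact.
  exact: continuous_subspaceT.
have [I dI] : exists I : R -> R, forall t : R, `|t| < 1 -> is_derive t 1 I (g t).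
  exists (fun x : R => (\int[@lebesgue_measure R]_(t in [set` `[(-1), x]]) (g t))%R).
  move=> t; rewrite ltr_norml => /andP[t1 t2].
  have [dI IE] := continuous_FTC1_closed t2 gi t1 (cg t).
  exact: (DeriveDef dI (etrans (esym (derive1E _ _)) IE)).
exists (fun t => I t - (I 0 - c)); first by rewrite subKr.
by move=> t /dI D; apply: is_derive_eq; rewrite subr0.
Qed.

Lemma antiderivative_rV (g : R -> 'rV[R]_n) (x0 : 'rV[R]_n) : continuous g ->
  exists2 G : R -> 'rV[R]_n, G 0 = x0 &
    forall t : R, `|t| < 1 -> is_derive t 1 G (g t).
Proof.
move=> cg.
have /choice[G GP] (k : 'I_n) : exists G : R -> R, G 0 = x0 ord0 k /\
    forall t : R, `|t| < 1 -> is_derive t 1 G (g t ord0 k).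
  have [|G] := @antiderivative (fun t => g t ord0 k) (x0 ord0 k); last by exists G.
  move=> t; exact: (continuous_comp (cg t) (@coord_continuous _ _ _ ord0 k (g t))).
exists (fun t => \row_k G k t).
  by apply/rowP => k; rewrite mxE (GP k).1.
move=> t t1; apply/is_derive_rVP => k.
have -> : (fun s => (\row_j G j s) ord0 k) = G k by apply/funext => s; rewrite mxE.
exact: (GP k).2.
Qed.

End VectorCurves.

Section Clamp.
Variable R : realType.
Implicit Types s t T : R.

(** Nearest-point retraction onto [-T, T]; it is 1-Lipschitz, so freezing a curve with it preserves
    Lipschitz bounds. *)
Definition clamp T t : R := Num.max (- T) (Num.min T t).

Lemma clamp_norm T t : 0 < T -> `|clamp T t| <= T.
Proof.
move=> T0; rewrite ler_norml /clamp le_max lexx/= ge_max ge_min lexx/=.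
by rewrite andbT; lra.
Qed.

Lemma clamp_id T t : `|t| <= T -> clamp T t = t.
Proof.
by rewrite ler_norml => /andP[Tt tT]; rewrite /clamp min_r// max_r.
Qed.

Lemma clamp_dist T s t : 0 < T -> `|clamp T s - clamp T t| <= `|s - t|.
Proof.
move=> T0; wlog ts : s t / t <= s => [H|].
  by case: (leP t s) => [/H//|/ltW/H]; rewrite distrC [leRHS]distrC.
rewrite [leRHS]ger0_norm ?subr_ge0// ler_norml /clamp.
have max_T : Num.max (- T) T = T by rewrite max_r//; lra.
by case: (leP T s) => Ts; case: (leP T t) => Tt; rewrite ?max_T;
  try (case: (leP (- T) s) => ?); try (case: (leP (- T) t) => ?); lra.
Qed.

End Clamp.

(** * Picard iteration for an autonomous equation *)

Section Picard.
Variables (R : realType) (n : nat) (F : 'rV[R]_n -> 'rV[R]_n) (x0 : 'rV[R]_n).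
Variables (M L T : R).
Hypotheses (M0 : 0 <= M) (L0 : 0 <= L) (T0 : 0 < T) (T1 : T < 1) (LT : L * T <= 1 / 2).
Hypothesis FM : forall x, `|x - x0| <= M * T -> `|F x| <= M.
Hypothesis FL : forall x y, `|x - x0| <= M * T -> `|y - x0| <= M * T ->
  `|F x - F y| <= L * `|x - y|.

(* Curves are defined on the whole line and frozen outside [-T, T] by [clamp T],
   so that every bound below is global in time. *)
Definition picard_curve (w : R -> 'rV[R]_n) : Prop :=
  [/\ w 0 = x0, forall s t, `|w s - w t| <= M * `|s - t| &
      forall t, `|w t - x0| <= M * T].

(** The integral operator as a relation: its values are produced only for Picard curves, along which
    [F] is controlled. *)
Definition picard_image (w G : R -> 'rV[R]_n) : Prop :=
  G 0 = x0 /\ forall t : R, `|t| < 1 -> is_derive t 1 G (F (w t)).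

Lemma picard_image_exists w : picard_curve w -> exists G, picard_image w G.
Proof.
move=> [_ wM wT].
have [|G] := @antiderivative_rV R n (F \o w) x0; last by exists G.
apply: (@lipschitz_continuous_curve _ _ _ (L * M)) => s t /=.
apply: (le_trans (FL (wT s) (wT t))).
by rewrite -mulrA ler_wpM2l.
Qed.

(** Along [w] the field has norm at most [M], so the image has speed at most [M] and in time [T]
    cannot leave the ball of radius [M * T]. *)
Lemma picard_image_curve w G : picard_curve w -> picard_image w G ->
  picard_curve (G \o clamp T).
Proof.
move=> [w0 wM wT] [G0 dG].
have GM s t : `|G (clamp T s) - G (clamp T t)| <= M * `|clamp T s - clamp T t|.
  apply: (@mean_value_norm_le _ _ _ (F \o w) _ _ _ T); rewrite ?clamp_norm//.
    by move=> r rT; apply: dG; exact: le_lt_trans T1.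
  by move=> r _; apply: FM.
have c0 : clamp T 0 = 0 by rewrite clamp_id// normr0 ltW.
split=> /= [|s t|t]; first by rewrite c0.
  by apply: (le_trans (GM s t)); rewrite ler_wpM2l// clamp_dist.
have := GM t 0; rewrite c0 G0 subr0 => /le_trans; apply.
by rewrite ler_wpM2l// clamp_norm.
Qed.

(** The difference of the images starts at 0 and has speed at most [L * D]; over time [T] this
    amounts to at most half of [D] because [L * T <= 1 / 2]. *)
Lemma picard_contraction w v G H (D : R) : picard_curve w -> picard_curve v ->
  picard_image w G -> picard_image v H -> (forall t, `|w t - v t| <= D) ->
  forall t, `|G (clamp T t) - H (clamp T t)| <= D / 2.
Proof.
move=> [w0 wM wT] [v0 vM vT] [G0 dG] [H0 dH] wvD t.
have D0 : 0 <= D by exact: le_trans (wvD 0).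
have c0 : clamp T 0 = 0 by rewrite clamp_id// normr0 ltW.
have := @mean_value_norm_le _ _ (fun t => G t - H t) (fun t => F (w t) - F (v t))
  (L * D) 0 (clamp T t) T.
rewrite G0 H0 !subrr !subr0 normr0 clamp_norm// => /(_ _ _ (ltW T0) isT) Hm.
apply: (@le_trans _ _ (L * D * `|clamp T t|)).
  apply: Hm => r rT.
    have r1 : `|r| < 1 by exact: le_lt_trans T1.
    by have := dG r r1; have := dH r r1 => dHr dGr; apply: is_deriveB.
  by apply: (le_trans (FL (wT r) (vT r))); rewrite ler_wpM2l.
apply: (@le_trans _ _ (L * D * T)); first by rewrite ler_wpM2l ?mulr_ge0// clamp_norm.
by rewrite mulrAC [leRHS]mulrC ler_wpM2r// (le_trans LT)// div1r.
Qed.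

(** Iterating from the constant curve, successive gaps halve; the limit is again a Picard curve and
    a fixed point of the integral operator, hence an integral curve. *)
Lemma picard : exists w : R -> 'rV[R]_n,
  [/\ w 0 = x0, forall s t, `|w s - w t| <= M * `|s - t| &
      forall t : R, `|t| < T -> is_derive t 1 w (F (w t))].
Proof.
(* A total operator is needed for the recursion; a curve that is not Picard gets itself as a dummy
   value. *)
have /choice[P PP] (w : R -> 'rV[R]_n) : exists G, picard_curve w -> picard_image w G.
  have [/picard_image_exists[G wG]|wn] := pselect (picard_curve w); first by exists G.
  by exists w => /wn.
pose W := fix W k := if k is k'.+1 then P (W k') \o clamp T else cst x0.
have MT0 : 0 <= M * T by rewrite mulr_ge0// ltW.
have Wc k : picard_curve (W k).
  elim: k => [|k IH] /=; last exact: picard_image_curve (PP _ IH).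
  by split=> [//|s t|t]; rewrite /cst subrr normr0// mulr_ge0.
have Wd k t : `|W k.+1 t - W k t| <= M * T / 2 ^+ k.
  elim: k t => [|k IH] t.
    by rewrite expr0 divr1; have [_ _] := Wc 1%N; exact.
  rewrite exprSr invfM mulrA.
  exact: (picard_contraction (Wc k.+1) (Wc k) (PP _ (Wc _)) (PP _ (Wc _)) IH).
have /choice[l lP] (t : R) : exists l, forall k, `|W k t - l| <= 2 * (M * T) / 2 ^+ k.
  by apply: geometric_cvg_rV => // k; exact: Wd.
have lc : picard_curve l.
  split=> [|s t|t].
  - apply/eqP; rewrite -subr_eq0 -normr_le0; apply: le_geometric => k.
    by rewrite add0r distrC; have [<- _ _] := Wc k; exact: lP.
  - apply: (@le_geometric _ _ _ (2 * (2 * (M * T)))) => k.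
    have [_ /(_ s t) H _] := Wc k; have H1 := lP s k; have H2 := lP t k.
    have -> : l s - l t = (W k s - W k t) + ((W k t - l t) - (W k s - l s)).
      by rewrite opprB addrA subrKA addrC addrA subrK.
    rewrite (le_trans (ler_normD _ _))// lerD// (le_trans (ler_normB _ _))//.
    by rewrite -mulrA mulr_natl mulr2n lerD.
  - apply: (@le_geometric _ _ _ (2 * (M * T))) => k.
    have [_ _ /(_ t) H] := Wc k.
    have -> : l t - x0 = (W k t - x0) - (W k t - l t) by rewrite opprB [RHS]addrC subrKA.
    by rewrite (le_trans (ler_normB _ _))// lerD.
(* Fixed point: both sides are within a geometrically small distance of [W k.+1 t]. *)
have lE t : l t = P l (clamp T t).
  apply/eqP; rewrite -subr_eq0 -normr_le0.
  apply: (@le_geometric _ _ _ (2 * (2 * (M * T)))) => k; rewrite add0r.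
  have := picard_contraction (Wc k) lc (PP _ (Wc k)) (PP _ lc) (fun t => lP t k) t.
  move=> H; have H1 := lP t k.+1.
  have -> : l t - P l (clamp T t) = (W k.+1 t - P l (clamp T t)) - (W k.+1 t - l t).
    by rewrite opprB [RHS]addrC subrKA.
  rewrite (le_trans (ler_normB _ _))// -mulrA mulr_natl mulr2n lerD//.
    by apply: (le_trans H); rewrite ler_pdivrMr// ler_peMr// ?ler1n// divr_ge0 ?exprn_ge0// mulr_ge0.
  apply: (le_trans H1); apply: ler_wpM2l; first by rewrite mulr_ge0.
  rewrite lef_pV2 ?posrE ?exprn_gt0//.
  by rewrite ler_eXn2l// ?ltr1n.
exists l; have [l0 lM _] := lc; split=> // t tT.
(* [P l] has the right derivative at [t], and it coincides with [l] near [t] because [clamp T] is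
   the identity there. *)
have [_ /(_ t (lt_trans tT T1)) D] := PP _ lc.
apply: near_eq_is_derive D.
have : \forall s \near t, `|s| < T.
  have : {for t, continuous (fun s : R => `|s|)} by exact: norm_continuous.
  by move/cvgr_lt; apply.
by apply: filterS => s sT; rewrite lE clamp_id// ltW.
Qed.

End Picard.

(** * Descent along two successive flows *)

Section LocalEstimates.
Variables (R : realType) (n : nat).
Implicit Types (f g : 'rV[R]_n -> 'rV[R]_n) (u h : 'rV[R]_n -> R) (x y : 'rV[R]_n).

Lemma norm_segment_lt x y z (r t : R) : 0 <= t <= 1 ->
  `|x - z| < r -> `|y - z| < r -> `|y + t *: (x - y) - z| < r.
Proof.
move=> /andP[t0 t1] xr yr.
have -> : y + t *: (x - y) - z = t *: (x - z) + (1 - t) *: (y - z).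
  by apply/rowP => i; rewrite !mxE; ring.
rewrite (le_lt_trans (ler_normD _ _))// !normrZ !ger0_norm ?subr_ge0//.
move: (`|x - z|) (`|y - z|) xr yr => a b ar br.
have [->|tn0] := eqVneq t 0; first by rewrite mul0r add0r subr0 mul1r.
have tp : 0 < t by rewrite lt_def tn0.
have -> : r = t * r + (1 - t) * r by ring.
by rewrite ltr_leD ?ltr_pM2l// ler_wpM2l ?subr_ge0// ltW.
Qed.

Lemma increment_le h (K r : R) x y z : Ck 1 h ->
  (forall v, `|v - z| < r -> \sum_(j < n) `|partial j h v| <= K) ->
  `|x - z| < r -> `|y - z| < r -> `|h x - h y| <= K * `|x - y|.
Proof.
move=> Ch hK xr yr.
pose w t := y + t *: (x - y).
have dw (t : R) : is_derive t 1 w (x - y).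
  have := @is_derive_line R _ _ (@id 'rV[R]_n) y (x - y) t.
  by rewrite derive_id; apply; exact: derivable_id.
have [|t /andP[t0 t1]] := @MVT_closed R (h \o w)
    (fun t => \sum_(j < n) partial j h (w t) * (x - y) ord0 j) 0 1 ler01.
  by move=> t _; exact: is_derive_comp_partial.
rewrite /= {1 2}/w scale1r scale0r addr0 subrKC subr0 mulr1 => ->.
apply: (le_trans (ler_norm_sum _ _ _)).
apply: (@le_trans _ _ (\sum_(j < n) `|partial j h (w t)| * `|x - y|)).
  by apply: ler_sum => j _; rewrite normrM ler_wpM2l// coord_le_norm.
rewrite -mulr_suml ler_wpM2r// hK// norm_segment_lt//.
by rewrite t0.
Qed.

(** On a small ball [f] and its partials exceed their norms at [x] by at most 1; the ball is convex,
    so the mean value theorem on segments gives the Lipschitz constant [L]. *)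
Lemma locally_bounded_lipschitz f x : Ck 1 f ->
  exists r M L : R, [/\ 0 < r, 0 <= M, 0 <= L,
    forall y, `|y - x| < r -> `|f y| <= M &
    forall y z, `|y - x| < r -> `|z - x| < r -> `|f y - f z| <= L * `|y - z|].
Proof.
move=> Cf; have [cf [df pf]] := Cf.
pose L := \sum_(j < n) (`|partial j f x| + 1).
have nf (V : normedModType R) (w : 'rV[R]_n -> V) : {for x, continuous w} ->
    \forall y \near x, `|w y| <= `|w x| + 1.
  move=> cw; have /cvgrPdist_le/(_ 1 ltr01) := cw; apply: filterS => y wy.
  by rewrite -lerBlDl (le_trans (lerB_dist _ _))// distrC.
have N1 : \forall y \near x, `|f y| <= `|f x| + 1 by apply: nf; exact: cf.
have N2 : \forall y \near x, forall j, `|partial j f y| <= `|partial j f x| + 1.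
  have := @filter_forall 'rV[R]_n 'I_n
    (fun j y => `|partial j f y| <= `|partial j f x| + 1) (nbhs x) _.
  by apply => j; apply: nf; exact: pf.
have N : \forall y \near x, `|f y| <= `|f x| + 1 /\
    forall j, `|partial j f y| <= `|partial j f x| + 1 by exact: filterI.
have /nbhs_ballP[r /= r0 rP] := N.
have {}rP y : `|y - x| < r -> `|f y| <= `|f x| + 1 /\
    forall j, `|partial j f y| <= `|partial j f x| + 1.
  by move=> yr; apply: rP; rewrite -ball_normE/= distrC.
have L0 : 0 <= L by apply: sumr_ge0 => j _; rewrite addr_ge0.
exists r, (`|f x| + 1), L; split=> //.
  by move=> y /rP[].
move=> y z yr zr; apply: norm_rV_le => [|k]; first by rewrite mulr_ge0.
rewrite !mxE.
apply: (@increment_le (fun v => f v ord0 k) L r y z x) => //; first exact: Ck1_coord.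
move=> v /rP[_ vP]; apply: ler_sum => j _; rewrite partial_coord//.
exact: le_trans (coord_le_norm _ _) (vP j).
Qed.

(** Radius, speed bound and time threshold are uniform in the starting point, as the descent
    estimate requires. *)
Lemma flow_exists f x : Ck 1 f -> exists r M T0 : R,
  [/\ 0 < r, 0 <= M, 0 < T0 &
    forall T y, 0 < T < T0 -> `|y - x| < r ->
    exists w : R -> 'rV[R]_n, [/\ w 0 = y,
      forall s t, `|w s - w t| <= M * `|s - t| &
      forall t : R, `|t| < T -> is_derive t 1 w (f (w t))]].
Proof.
move=> /(@locally_bounded_lipschitz _ x)[r [M [L [r0 M0 L0 fM fL]]]].
have M1 : 0 < M + 1 by rewrite ltr_pwDr.
have L1 : 0 < 2 * (L + 1) by rewrite mulr_gt0// ltr_pwDr.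
(* The three bounds give [T < 1], [L * T <= 1 / 2], and [M * T < r / 2], which keeps a curve started
   in the half ball inside the ball of radius [r]. *)
pose T0 := Num.min 1 (Num.min (2 * (L + 1))^-1 (r / 2 / (M + 1))).
exists (r / 2), M, T0; split=> //; first by rewrite divr_gt0.
  by rewrite /T0 !lt_min ltr01 invr_gt0 L1 !divr_gt0.
move=> T y /andP[Tp]; rewrite /T0 !lt_min => /and3P[T1 TL TM] yr.
have LT : L * T <= 1 / 2.
  move: TL; rewrite -[ltRHS]div1r ltr_pdivlMr//; move: Tp L0; clear; nra.
have MT : M * T < r / 2.
  by move: TM; rewrite ltr_pdivlMr//; move: Tp M0; clear; nra.
have near_x z : `|z - y| <= M * T -> `|z - x| < r.
  move=> zy; rewrite -(subrKA y) (le_lt_trans (ler_normD _ _))//.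
  by move: zy MT yr; move: (`|z - y|) (`|y - x|) => a b; clear; lra.
apply: (@picard R n f y M L T) => //.
  by move=> z /near_x; exact: fM.
by move=> z z' /near_x zr /near_x zr'; exact: fL.
Qed.

End LocalEstimates.

(** * Second-order expansion along two arcs *)

Section Descent.
Variables (R : realType) (n : nat).
Implicit Types (f g : 'rV[R]_n -> 'rV[R]_n) (u h : 'rV[R]_n -> R) (x y : 'rV[R]_n).

Lemma increment_along f h (w : R -> 'rV[R]_n) (K s T : R) : 0 <= s < T -> Ck 1 h ->
  (forall t : R, `|t| < T -> is_derive t 1 w (f (w t))) ->
  (forall t, 0 <= t <= s -> lie_derivative f h (w t) <= K) ->
  h (w s) <= h (w 0) + K * s.
Proof.
move=> /andP[s0 sT] Ch dw hK; rewrite -[s in K * s]subr0.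
apply: (@derive_le_increment R (h \o w) (lie_derivative f h \o w)) => // t /andP[t0 ts].
by apply: is_derive_along => //; apply: dw; rewrite ger0_norm// (le_lt_trans ts).
Qed.

Lemma taylor2_along f h (w : R -> 'rV[R]_n) (K s T : R) : 0 <= s < T ->
  Ck 1 f -> Ck 2 h ->
  (forall t : R, `|t| < T -> is_derive t 1 w (f (w t))) ->
  (forall t, 0 <= t <= s -> lie_derivative f (lie_derivative f h) (w t) <= K) ->
  h (w s) <= h (w 0) + s * lie_derivative f h (w 0) + s ^+ 2 / 2 * K.
Proof.
move=> /andP[s0 sT] Cf Ch dw hK.
apply: (@taylor2_le R (h \o w) (lie_derivative f h \o w)
  (lie_derivative f (lie_derivative f h) \o w)) => // t /andP[t0 ts];
  have {}dw := dw t ltac:(by rewrite ger0_norm// (le_lt_trans ts)).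
- exact: is_derive_along (CkS_Ck Ch) dw.
- exact: is_derive_along (Ck1_lie_derivative Cf Ch) dw.
Qed.

(** Taylor expansion of [u] along each arc leaves [lie_derivative g u] at the junction [v s]; a
    first-order estimate along the first arc brings it back to [y] and produces the factor 2 of the
    mixed term. *)
Lemma two_flows_descent f g u x : Ck 1 f -> Ck 1 g -> Ck 2 u ->
  let q := lie_derivative f (lie_derivative f u) x
    + 2 * lie_derivative f (lie_derivative g u) x
    + lie_derivative g (lie_derivative g u) x in
  q < 0 ->
  exists r s0 : R, [/\ 0 < r, 0 < s0 &
    forall s y, 0 < s < s0 -> `|y - x| < r ->
    exists (v w : R -> 'rV[R]_n) (M T : R), [/\ v 0 = y /\ w 0 = v s, s < T,
      (forall t t', `|v t - v t'| <= M * `|t - t'|) /\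
      (forall t t', `|w t - w t'| <= M * `|t - t'|),
      (forall t : R, `|t| < T -> is_derive t 1 v (f (v t))) /\
      (forall t : R, `|t| < T -> is_derive t 1 w (g (w t))) &
      u (w s) <= u y + s * (lie_derivative f u y + lie_derivative g u y)
        + s ^+ 2 / 4 * q]].
Proof.
move=> Cf Cg Cu q q0.
have Cfu := Ck1_lie_derivative Cf Cu; have Cgu := Ck1_lie_derivative Cg Cu.
have [cf _] := Cf; have [cg _] := Cg.
have [rf [Mf [Tf [rf0 Mf0 Tf0 Hf]]]] := flow_exists x Cf.
have [rg [Mg [Tg [rg0 Mg0 Tg0 Hg]]]] := flow_exists x Cg.
(* The error [e] enters with total weight 4 inside [s ^+ 2 / 2 * (q + 4 * e)], so this choice leaves
   exactly [s ^+ 2 / 4 * q]. *)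
pose e := - q / 8; have e0 : 0 < e by rewrite /e; move: q0; move: (q) => q'; clear; lra.
have near_le h : continuous h ->
    exists2 r : R, 0 < r & forall y, `|y - x| < r -> h y <= h x + e.
  move=> ch; have /cvgrPdist_le/(_ _ e0)/nbhs_ballP[r /= r0 rP] := ch x.
  exists r => // y yr; have := rP y; rewrite -ball_normE/= distrC => /(_ yr).
  by rewrite ler_norml; move: (h y) (h x) (e) => a b c; clear; lra.
have [r1 r10 ff_le] := near_le _ (continuous_lie_derivative cf Cfu).
have [r2 r20 fg_le] := near_le _ (continuous_lie_derivative cf Cgu).
have [r3 r30 gg_le] := near_le _ (continuous_lie_derivative cg Cgu).
pose r := Num.min (Num.min rf rg) (Num.min r1 (Num.min r2 r3)).
have r0 : 0 < r by rewrite !lt_min rf0 rg0 r10 r20 r30.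
pose M := Num.max Mf Mg.
have MfM : Mf <= M by rewrite le_max lexx.
have MgM : Mg <= M by rewrite le_max lexx orbT.
have M0 : 0 <= M by exact: le_trans MfM.
pose T := Num.min Tf Tg / 2.
have T0 : 0 < T by rewrite divr_gt0// lt_min Tf0.
have TT : T < Num.min Tf Tg.
  by rewrite /T ltr_pdivrMr// ltr_pMr ?ltr1n// lt_min Tf0.
have [TTf TTg] : T < Tf /\ T < Tg by move: TT; rewrite lt_min => /andP[].
(* Each arc moves by less than [r / 3]; with a start within [r / 3] of [x], both arcs stay in the
   ball of radius [r]. *)
pose s0 := Num.min T (r / 3 / (M + 1)).
exists (r / 3), s0; split; first by rewrite divr_gt0.
  by rewrite lt_min T0 !divr_gt0// ltr_pwDr.
move=> s y /andP[sp]; rewrite lt_min => /andP[sT sr] yr.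
have Ms : M * s < r / 3.
  move: sr; rewrite ltr_pdivlMr ?ltr_pwDr//.
  by move: sp M0; move: (M) (r / 3) => a b; clear; nra.
have rle z : `|z - x| < r ->
    [/\ `|z - x| < rf, `|z - x| < rg, `|z - x| < r1, `|z - x| < r2 & `|z - x| < r3].
  by rewrite !lt_min => /andP[/andP[-> ->] /and3P[-> -> ->]].
have yx : `|y - x| < r.
  by apply: (lt_le_trans yr); move: r0; move: (r) => a; clear; lra.
have [yf _ _ _ _] := rle _ yx.
have [|v [v0 vM dv]] := Hf T y _ yf; first by rewrite T0.
have {}vM t t' : `|v t - v t'| <= M * `|t - t'|.
  by apply: (le_trans (vM t t')); rewrite ler_wpM2r.
have vx t : 0 <= t <= s -> `|v t - x| < r / 3 + r / 3.
  move=> /andP[t0 ts]; rewrite -(subrKA y) (le_lt_trans (ler_normD _ _))//.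
  rewrite ler_ltD//; have := vM t 0; rewrite v0 subr0 (ger0_norm t0) => /le_trans; apply.
  by apply: le_trans (ltW Ms); rewrite ler_wpM2l.
have s_s : 0 <= s <= s by rewrite ltW//=.
have vsx : `|v s - x| < r.
  by apply: (lt_le_trans (vx s s_s)); move: r0; move: (r) => a; clear; lra.
have [_ vsg _ _ _] := rle _ vsx.
have [|w [w0 wM dw]] := Hg T (v s) _ vsg; first by rewrite T0.
have {}wM t t' : `|w t - w t'| <= M * `|t - t'|.
  by apply: (le_trans (wM t t')); rewrite ler_wpM2r.
have wx t : 0 <= t <= s -> `|w t - x| < r.
  move=> /andP[t0 ts]; rewrite -(subrKA (v s)) (le_lt_trans (ler_normD _ _))//.
  have -> : r = r / 3 + (r / 3 + r / 3) by move: (r) => a; clear; lra.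
  rewrite ler_ltD ?vx//; have := wM t 0; rewrite w0 subr0 (ger0_norm t0) => /le_trans; apply.
  by apply: le_trans (ltW Ms); rewrite ler_wpM2l.
have {}vx t : 0 <= t <= s -> `|v t - x| < r.
  by move=> /vx /lt_le_trans; apply; move: r0; move: (r) => a; clear; lra.
exists v, w, M, T; split=> //.
have sT' : 0 <= s < T by rewrite ltW.
have U1 := taylor2_along (K := lie_derivative f (lie_derivative f u) x + e) sT' Cf Cu dv.
have U2 := increment_along (K := lie_derivative f (lie_derivative g u) x + e) sT' Cgu dv.
have U3 := taylor2_along (K := lie_derivative g (lie_derivative g u) x + e) sT' Cg Cu dw.
have {}U1 := U1 (fun t ts => let: And5 _ _ h _ _ := rle _ (vx t ts) in ff_le _ h).
have {}U2 := U2 (fun t ts => let: And5 _ _ _ h _ := rle _ (vx t ts) in fg_le _ h).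
have {}U3 := U3 (fun t ts => let: And5 _ _ _ _ h := rle _ (wx t ts) in gg_le _ h).
move: U1 (ler_wpM2l (ltW sp) U2) U3; rewrite v0 w0 /e /q expr2.
move: (lie_derivative f (lie_derivative f u) x) (lie_derivative f (lie_derivative g u) x).
move: (lie_derivative g (lie_derivative g u) x) (lie_derivative g u (v s)).
move: (lie_derivative f u y) (lie_derivative g u y) (u (w s)) (u (v s)) (u y).
by clear => *; lra.
Qed.

End Descent.

(** * Two arcs as one admissible trajectory *)

Section Concatenation.
Variables (R : realType) (n m : nat) (sigma : 'I_m -> 'rV[R]_n -> 'rV[R]_n).
Implicit Types (a b : 'rV[R]_m) (u : 'rV[R]_n -> R).

(** The multiples of [s] have the switching time as a node, and serve both for the control and for
    the exceptional times of the trajectory. *)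
Lemma arithmetic_partition (s : R) : 0 < s -> partition_seq (fun k => k%:R * s).
Proof.
move=> s0; split; first by rewrite mul0r.
split=> [k|M]; first by rewrite ltr_pM2r// ltr_nat.
exists (Num.bound (`|M| / s)); rewrite (le_lt_trans (ler_norm M))// -ltr_pdivrMr//.
by apply: archi_boundP; rewrite divr_ge0// ltW.
Qed.

Definition switch_control a b (s t : R) : 'rV[R]_m := if t < s then a else b.

Lemma admissible_switch_control a b (s : R) : 0 < s -> unit_ball a -> unit_ball b ->
  admissible_control (switch_control a b s).
Proof.
move=> s0 a1 b1; split; last by move=> t _; rewrite /switch_control; case: ifP.
exists (fun k => k%:R * s); split; first exact: arithmetic_partition.
move=> k; exists (cst (if k is 0 then a else b)); split.
  by apply: continuous_subspaceT; exact: cst_continuous.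
move=> t /andP[kt tk]; rewrite /switch_control /cst; case: k kt tk => [|k] kt tk.
  by move: tk; rewrite mul1r => ->.
case: ltP => // ts; have : k.+1%:R * s < 1 * s by rewrite mul1r (lt_trans kt).
by rewrite ltr_pM2r// ltNge ler1n.
Qed.

Lemma concatenation_reach a b u x y (s t M T : R) (v w : R -> 'rV[R]_n) :
  0 < s -> s + s < t -> s < T -> unit_ball a -> unit_ball b ->
  v 0 = y -> w 0 = v s ->
  (forall r r', `|v r - v r'| <= M * `|r - r'|) ->
  (forall r r', `|w r - w r'| <= M * `|r - r'|) ->
  (forall r : R, `|r| < T -> is_derive r 1 v (sigma_a sigma a (v r))) ->
  (forall r : R, `|r| < T -> is_derive r 1 w (sigma_a sigma b (w r))) ->
  u (w s) <= u x -> reach_set sigma u x t y.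
Proof.
move=> s0 st sT a1 b1 v0 w0 vM wM dv dw uw.
exists (switch_control a b s); split; first exact: admissible_switch_control.
exists (s + s); split; first by rewrite st andbT addr_ge0// ltW.
(* Equals [v r] before [s] and [w (r - s)] after, but is visibly Lipschitz. *)
pose z r := v (Num.min r s) + (w (Num.max (r - s) 0) - v s).
have zv r : r <= s -> z r = v r.
  by move=> rs; rewrite /z min_l// max_r ?subr_le0// w0 subrr addr0.
have zw r : s <= r -> z r = w (r - s).
  by move=> sr; rewrite /z min_r// max_l ?subr_ge0// subrKC.
exists z; split; last by rewrite zw ?addrK// lerDl ltW.
have M0 : 0 <= M by have := vM 1 0; rewrite subr0 normr1 mulr1; exact: le_trans.
split; first by rewrite zv// ltW.
split.
  apply: continuous_subspaceT; apply: (@lipschitz_continuous_curve R _ z (M + M)) => r r'.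
  rewrite /z opprD addrACA opprD [X in _ + X]addrACA subrr addr0.
  rewrite (le_trans (ler_normD _ _))// mulrDl lerD//.
    apply: (le_trans (vM _ _)); rewrite ler_wpM2l//.
    wlog rr : r r' / r' <= r => [H|].
      by case: (leP r' r) => [/H//|/ltW/H]; rewrite distrC [leRHS]distrC.
    rewrite [leRHS]ger0_norm ?subr_ge0// ler_norml; move: rr; clear.
    by case: (leP r s) => ?; case: (leP r' s) => ? ?; lra.
  apply: (le_trans (wM _ _)); rewrite ler_wpM2l//.
  wlog rr : r r' / r' <= r => [H|].
    by case: (leP r' r) => [/H//|/ltW/H]; rewrite distrC [leRHS]distrC.
  rewrite [leRHS]ger0_norm ?subr_ge0// ler_norml; move: rr; clear.
  by case: (leP (r - s) 0) => ?; case: (leP (r' - s) 0) => ? ?; lra.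
exists (fun k => k%:R * s); split; first exact: arithmetic_partition.
move=> r /andP[r0 rss] rk.
(* The switching time is the node of index 1, hence exempt from the differential equation. *)
have /eqP rs : r <> s by have := rk 1%N; rewrite mul1r.
rewrite /switch_control; case: ltP => [r_lt|r_ge].
  rewrite zv ?ltW//; apply: near_eq_is_derive (dv r _); last first.
    by rewrite gtr0_norm// (lt_trans r_lt).
  have : \forall p \near r, p < s by exact: lt_nbhsl.
  by apply: filterS => p ps; rewrite zv ?ltW.
have r_gt : s < r by rewrite lt_neqAle eq_sym rs.
rewrite zw//.
have rs0 : 0 <= r - s by rewrite subr_ge0.
have rsT : `|r - s| < T.
  by rewrite ger0_norm// (lt_trans _ sT)// ltrBlDr.
(* The time shift is written as a line in [R] so that [is_derive_line] applies. *)
have D : is_derive r 1 (fun p => w (- s + p *: 1)) (sigma_a sigma b (w (r - s))).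
  have [dwr <-] := dw _ rsT.
  have E : - s + r *: 1 = r - s by rewrite [r *: 1]mulr1 addrC.
  by rewrite -E; apply: is_derive_line; rewrite E.
apply: near_eq_is_derive D.
have : \forall p \near r, s < p by exact: lt_nbhsr.
by apply: filterS => p ps; rewrite zw ?ltW// [p *: 1]mulr1 addrC.
Qed.

End Concatenation.

(** * Reversing the controls, and the conclusion *)

Section SignSymmetry.
Variables (R : realType) (n m : nat) (sigma : 'I_m -> 'rV[R]_n -> 'rV[R]_n).

Lemma sigma_aD (a b : 'rV[R]_m) :
  sigma_a sigma (a + b) = (fun x => sigma_a sigma a x + sigma_a sigma b x).
Proof.
apply/funext => x; rewrite /sigma_a -big_split/=; apply: eq_bigr => i _.
by rewrite mxE scalerDl.
Qed.

Lemma sigma_aN (a : 'rV[R]_m) : sigma_a sigma (- a) = (fun x => - sigma_a sigma a x).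
Proof.
apply/funext => x; rewrite /sigma_a -sumrN; apply: eq_bigr => i _.
by rewrite mxE scaleNr.
Qed.

Lemma Ck1_sigma_a (a : 'rV[R]_m) : (forall i, Ck 1 (sigma i)) -> Ck 1 (sigma_a sigma a).
Proof. by move=> Cs; apply: Ck1_sum => i; apply: Ck1Z. Qed.

Lemma unit_ballN (a : 'rV[R]_m) : unit_ball a -> unit_ball (- a).
Proof.
rewrite /unit_ball/= /dotv; congr (_ <= _); apply: eq_bigr => i _.
by rewrite !mxE mulrNN.
Qed.

Lemma lie_derivativeNl (f : 'rV[R]_n -> 'rV[R]_n) (h : 'rV[R]_n -> R) :
  lie_derivative (fun x => - f x) h = (fun x => - lie_derivative f h x).
Proof.
apply/funext => x; rewrite /lie_derivative -sumrN; apply: eq_bigr => j _.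
by rewrite mxE mulrN.
Qed.

(** The two sign changes cancel, so the second-order coefficient is the same for the reversed pair
    of fields. *)
Lemma lie_derivative2NN (f g : 'rV[R]_n -> 'rV[R]_n) (h : 'rV[R]_n -> R) x :
  Ck 1 g -> Ck 2 h ->
  lie_derivative (fun x => - f x) (lie_derivative (fun x => - g x) h) x =
  lie_derivative f (lie_derivative g h) x.
Proof.
move=> Cg Ch; have [_ [dgh _]] := Ck1_lie_derivative Cg Ch.
rewrite !lie_derivativeNl /lie_derivative -sumrN; apply: eq_bigr => j _.
rewrite -mulNr; congr (_ * _).
by rewrite /partial [X in - X](deriveN (dgh j x)) opprK.
Qed.

End SignSymmetry.

Theorem theorem1 (R : realType) (n m : nat)
  (sigma : 'I_m -> 'rV[R]_n -> 'rV[R]_n) (u : 'rV[R]_n -> R) (xbar : 'rV[R]_n) :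
  (forall i, Ck 2 (sigma i)) ->
  Ck 3 u ->
  (forall i, dotv (grad u xbar) (sigma i xbar) = 0) ->
  (exists a1 a2 : 'rV[R]_m, unit_ball a1 /\ unit_ball a2 /\
     0 < - trvv (hess u xbar) (sigma_a sigma (a1 + a2) xbar)
         - dotv (mxapp (jac (sigma_a sigma (a1 + a2)) xbar) (sigma_a sigma (a1 + a2) xbar)
                 + lie (sigma_a sigma a1) (sigma_a sigma a2) xbar)
                (grad u xbar)) ->
  STLA sigma u xbar.
Proof.
move=> /(_ _)/CkS_Ck Cs /CkS_Ck Cu _ [a [b [a1 [b1]]]].
pose f := sigma_a sigma a; pose g := sigma_a sigma b.
have Cf : Ck 1 f by exact: Ck1_sigma_a.
have Cg : Ck 1 g by exact: Ck1_sigma_a.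
rewrite sigma_aD -/f -/g -opprD oppr_gt0 -second_order_bracket// => q0 t t0.
have [r1 [s1 [r10 s10 H1]]] := two_flows_descent Cf Cg Cu q0.
have CfN : Ck 1 (fun x => - f x) by rewrite -sigma_aN; exact: Ck1_sigma_a.
have CgN : Ck 1 (fun x => - g x) by rewrite -sigma_aN; exact: Ck1_sigma_a.
(* The same estimate for the reversed controls, with the first-order term of opposite sign. *)
have [|r2 [s2 [r20 s20 H2]]] := two_flows_descent (x := xbar) CfN CgN Cu.
  by rewrite !lie_derivative2NN.
move: H1 H2 q0; rewrite !lie_derivative2NN//; set q := (X in X < 0) => H1 H2 q0.
(* Small enough for both estimates, with total travel time [s + s] below [t]. *)
pose s := Num.min (Num.min s1 s2) (t / 2) / 2.
have min_gt0 : 0 < Num.min (Num.min s1 s2) (t / 2) by rewrite !lt_min s10 s20 divr_gt0.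
have s_gt0 : 0 < s by rewrite divr_gt0.
have : s < Num.min (Num.min s1 s2) (t / 2) by rewrite ltr_pdivrMr// ltr_pMr ?ltr1n.
rewrite !lt_min => /andP[/andP[ss1 ss2] st].
have {}st : s + s < t by move: st; clear; lra.
(* This is the guaranteed gain. As [s] is now fixed, continuity of [u] yields a ball on which [u y]
   exceeds [u xbar] by no more than this amount. *)
have e0 : 0 < - (s ^+ 2 / 4 * q).
  by rewrite oppr_gt0 pmulr_rlt0 ?divr_gt0 ?exprn_gt0.
have [cu _] := Cu.
have /cvgrPdist_le/(_ _ e0)/nbhs_ballP[r3 /= r30 H3] := cu xbar.
apply/nbhs_ballP; exists (Num.min (Num.min r1 r2) r3) => /=.
  by rewrite !lt_min r10 r20.
move=> y; rewrite -ball_normE/= !lt_min distrC => /andP[/andP[yr1 yr2] yr3].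
have {}H3 : u y <= u xbar - s ^+ 2 / 4 * q.
  have := H3 y; rewrite -ball_normE/= distrC => /(_ yr3).
  rewrite ler_norml; move: (u y) (u xbar) (s ^+ 2 / 4 * q) => p p' p''; clear; lra.
(* The sign of the first-order term at [y] selects the controls: [a] then [b] if it is nonpositive,
   [- a] then [- b] otherwise. *)
have [neg|pos] := leP (lie_derivative f u y + lie_derivative g u y) 0.
  have [|v [w [M [T [[v0 w0] sT [vM wM] [dv dw] uw]]]]] := H1 s y _ yr1.
    by rewrite s_gt0.
  apply: (@concatenation_reach _ _ _ _ a b u xbar y s t M T v w) => //.
  apply: (le_trans uw); move: H3 (mulr_ge0_le0 (ltW s_gt0) neg).
  move: (s * _) (s ^+ 2 / 4 * q) (u y) (u xbar) => *; lra.
have [|v [w [M [T [[v0 w0] sT [vM wM] [dv dw] uw]]]]] := H2 s y _ yr2.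
  by rewrite s_gt0.
apply: (@concatenation_reach _ _ _ _ (- a) (- b) u xbar y s t M T v w) => //.
- exact: unit_ballN.
- exact: unit_ballN.
- by rewrite sigma_aN.
- by rewrite sigma_aN.
apply: (le_trans uw); rewrite !lie_derivativeNl.
move: H3 (mulr_ge0 (ltW s_gt0) (ltW pos)); rewrite -opprD mulrN.
move: (s * _) (s ^+ 2 / 4 * q) (u y) (u xbar) => *; lra.
Qed.
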